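(* For every finite distributive lattice $D$ and every group $G$, if $\kappa$ is an infinite cardinal with $\kappa\ge|G|$, then there is a lattice $L$ with $2^\kappa$ many ideals but only $\kappa$ many filters such that $D\cong\mathrm{Con}(L)$ and $G\cong\mathrm{Aut}(L)$.
   Context: $\mathrm{Con}(L)$ denotes the congruence lattice of the lattice $L$ and $\mathrm{Aut}(L)$ its automorphism group. Ideals and filters are lattice ideals and lattice filters of $L$.
   Formalization: The finite distributive lattice D is assumed to have at least two elements; for one-element D the claim is false, since Con(L) with one element forces L to have at most one element and hence not 2^κ ideals. *)

(* Defs.v *)
From HB Require Import structures.
From mathcomp Require Import all_boot all_order.
From mathcomp Require Import boolp classical_sets functions cardinality.

Set Implicit Arguments.
Unset Strict Implicit.
Unset Printing Implicit Defensive.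

Import Order.Theory.
Local Open Scope order_scope.

Section Ideals.
Context {d : Order.disp_t} {L : latticeType d}.

Definition lattice_ideal (I : set L) : Prop :=
  [/\ (I !=set0)%classic,
      forall x y, x <= y -> I y -> I x
    & forall x y, I x -> I y -> I (x `|` y)].

Definition lattice_filter (F : set L) : Prop :=
  [/\ (F !=set0)%classic,
      forall x y, x <= y -> F x -> F y
    & forall x y, F x -> F y -> F (x `&` y)].

End Ideals.

Section Isomorphisms.

Definition lattice_iso {d d' : Order.disp_t} {L : latticeType d}
    {M : latticeType d'} (f : L -> M) : Prop :=
  [/\ bijective f, Order.meet_morphism f & Order.join_morphism f].

Definition lattices_isomorphic {d d' : Order.disp_t} (L : latticeType d)
    (M : latticeType d') : Prop :=
  exists f : L -> M, lattice_iso f.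

Definition groups_isomorphic (G H : groupType) : Prop :=
  exists2 f : G -> H, bijective f & {morph f : x y / (x * y)%g}.

End Isomorphisms.

Section Congruences.
Context {d : Order.disp_t} (L : latticeType d).

Record Con := MkCon {
  con_rel :> L -> L -> Prop;
  con_refl : forall x, con_rel x x;
  con_sym : forall x y, con_rel x y -> con_rel y x;
  con_trans : forall x y z, con_rel x y -> con_rel y z -> con_rel x z;
  con_meet : forall x x' y y',
    con_rel x x' -> con_rel y y' -> con_rel (x `&` y) (x' `&` y');
  con_join : forall x x' y y',
    con_rel x x' -> con_rel y y' -> con_rel (x `|` y) (x' `|` y')
}.

Lemma con_ext (a b : Con) : (forall x y, a x y <-> b x y) -> a = b.
Proof.
case: a b => [a a1 a2 a3 a4 a5] [b b1 b2 b3 b4 b5] /= ab.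
have E : a = b by apply/funext => x; apply/funext => y; apply/propext.
by move: a1 a2 a3 a4 a5 b1 b2 b3 b4 b5; rewrite E => *;
  congr MkCon; apply: Prop_irrelevance.
Qed.

HB.instance Definition _ := gen_eqMixin Con.
HB.instance Definition _ := gen_choiceMixin Con.

Definition con_le (a b : Con) : bool := `[< forall x y, a x y -> b x y >].

Fact con_le_refl : reflexive con_le.
Proof. by move=> a; apply/asboolP. Qed.

Fact con_le_anti : antisymmetric con_le.
Proof.
move=> a b /andP[/asboolP ab /asboolP ba]; apply: con_ext => x y.
by split; [exact: ab | exact: ba].
Qed.

Fact con_le_trans : transitive con_le.
Proof.
by move=> b a c /asboolP ab /asboolP bc; apply/asboolP => x y /ab /bc.
Qed.

Fact con_display : Order.disp_t. Proof. exact: (Order.Disp tt tt). Qed.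

HB.instance Definition _ :=
  Order.Le_isPOrder.Build con_display Con con_le_refl con_le_anti con_le_trans.

#[local] Obligation Tactic := idtac.

Program Definition con_inter (a b : Con) : Con :=
  @MkCon (fun x y => a x y /\ b x y) _ _ _ _ _.
Next Obligation. by move=> a b x; split; apply: con_refl. Qed.
Next Obligation. by move=> a b x y [? ?]; split; apply: con_sym. Qed.
Next Obligation.
by move=> a b x y z [? ?] [? ?]; split; apply: (con_trans (y := y)).
Qed.
Next Obligation.
by move=> a b x x' y y' [? ?] [? ?]; split; apply: con_meet.
Qed.
Next Obligation.
by move=> a b x x' y y' [? ?] [? ?]; split; apply: con_join.
Qed.

(* The least congruence containing both a and b. *)
Program Definition con_sup (a b : Con) : Con :=
  @MkCon (fun x y => forall c : Con, a <= c -> b <= c -> c x y) _ _ _ _ _.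
Next Obligation. by move=> a b x c _ _; apply: con_refl. Qed.
Next Obligation.
by move=> a b x y xy c ac bc; apply: con_sym; apply: xy.
Qed.
Next Obligation.
move=> a b x y z xy yz c ac bc; apply: (con_trans (y := y)).
  exact: xy.
exact: yz.
Qed.
Next Obligation.
move=> a b x x' y y' xx' yy' c ac bc; apply: con_meet.
  exact: xx'.
exact: yy'.
Qed.
Next Obligation.
move=> a b x x' y y' xx' yy' c ac bc; apply: con_join.
  exact: xx'.
exact: yy'.
Qed.

Fact con_interP (a b c : Con) : (a <= con_inter b c) = (a <= b) && (a <= c).
Proof.
apply/asboolP/andP => [abc|[/asboolP ab /asboolP ac] x y axy].
  by split; apply/asboolP => x y /abc /= [].
by split; [exact: ab | exact: ac].
Qed.

Fact con_supP (a b c : Con) : (con_sup a b <= c) = (a <= c) && (b <= c).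
Proof.
apply/asboolP/andP => [abc|[ac bc] x y]; last exact.
by split; apply/asboolP => x y xy; apply: abc => e /asboolP ae /asboolP be;
  [exact: ae | exact: be].
Qed.

HB.instance Definition _ :=
  Order.POrder_MeetJoin_isLattice.Build con_display Con con_interP con_supP.

End Congruences.

Section Automorphisms.
Context {d : Order.disp_t} (L : latticeType d).

Record LAut := MkLAut {
  laut_fun :> L -> L;
  laut_iso : lattice_iso laut_fun
}.

Lemma laut_ext (f g : LAut) : f =1 g -> f = g.
Proof.
case: f g => [f fP] [g gP] /= /funext E; move: fP gP; rewrite E => fP gP.
by congr MkLAut; apply: Prop_irrelevance.
Qed.

HB.instance Definition _ := gen_eqMixin LAut.
HB.instance Definition _ := gen_choiceMixin LAut.

Fact laut_id_subproof : lattice_iso (@id L).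
Proof. by split=> //; exists id. Qed.

Definition laut_id : LAut := MkLAut laut_id_subproof.

Fact laut_comp_subproof (f g : LAut) : lattice_iso (f \o g).
Proof.
case: f g => [f [fb fm fj]] [g [gb gm gj]] /=; split; first exact: bij_comp.
  by move=> x y /=; rewrite gm fm.
by move=> x y /=; rewrite gj fj.
Qed.

Definition laut_comp (f g : LAut) : LAut := MkLAut (laut_comp_subproof f g).

Fact laut_inv_subproof (f : LAut) : exists g : LAut, cancel f g /\ cancel g f.
Proof.
case: f => [f [[g fK gK] fm fj]] /=.
have gP : lattice_iso g.
  split; first by exists f.
    by move=> x y; apply: (can_inj fK); rewrite fm !gK.
  by move=> x y; apply: (can_inj fK); rewrite fj !gK.
by exists (MkLAut gP).
Qed.

Definition laut_inv (f : LAut) : LAut := sval (cid (laut_inv_subproof f)).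

Fact laut_compA : associative laut_comp.
Proof. by move=> f g h; apply: laut_ext. Qed.

Fact laut_comp1f : left_id laut_id laut_comp.
Proof. by move=> f; apply: laut_ext. Qed.

Fact laut_compf1 : right_id laut_id laut_comp.
Proof. by move=> f; apply: laut_ext. Qed.

Fact laut_compVf : left_inverse laut_id laut_inv laut_comp.
Proof.
by move=> f; apply: laut_ext => x /=; rewrite /laut_inv; case: cid => g [].
Qed.

Fact laut_compfV : right_inverse laut_id laut_inv laut_comp.
Proof.
by move=> f; apply: laut_ext => x /=; rewrite /laut_inv; case: cid => g [].
Qed.

HB.instance Definition _ := isGroup.Build LAut
  laut_compA laut_comp1f laut_compf1 laut_compVf laut_compfV.

End Automorphisms.

(* Main.v *)
Require Import Defs.
From HB Require Import structures.
From mathcomp Require Import all_boot all_order.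
From mathcomp Require Import boolp classical_sets functions cardinality.
From mathcomp Require Import wochoice.

(** Let P be the set of join-primes of D, so that D is the lattice of down-sets
    of P. The lattice L is a lattice of subsets of the vertex set V of a graph
    whose vertices are coloured by P and whose edges join vertices of one
    colour. Say that v fills u when u and v are adjacent, or when the colour of
    u lies strictly below that of v. A set A is an element of L when

    - as soon as u and v are in A and v fills u, the whole colour class of u is
      contained in A;
    - A meets each colour class in a finite set or contains the class.

    The four requirements on L are then met for separate reasons.

    Congruences. If an element and a strictly larger one are identified, some
    vertex v is identified with the empty set. Joining with a neighbour of v and
    meeting with other vertices collapses the whole class of v; joining that
    class with one vertex of a lower colour collapses the lower class too. Hence
    a congruence amounts to a down-set of P, that is, to an element d of D: two
    sets are identified when they differ only in colours below d
    ([agree_off_le], [agree_off_surj]).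

    Filters and ideals. There are finitely many colours and a closed set is
    finite where it is not full, so every filter has a least element
    ([filter_principal]) and there are as many filters as elements, namely
    kappa. An independent set of kappa vertices of one colour has 2^kappa
    subsets, and each of them spans its own ideal ([card_ideals]).

    Automorphisms. The atoms of L are the singletons, so an automorphism of L
    permutes V. Adjacency can be read off from the joins of atoms
    ([edge_span]), hence Aut(L) is the automorphism group of the graph provided
    that graph automorphisms preserve colours ([laut_group_iso]).

    It remains to produce a graph with automorphism group G. Well-order an index
    set I of cardinality kappa that has no greatest element. Each colour p
    receives a clique indexed by I, the spine, and vertices off the spine, each
    with a level in I: a spine vertex i is adjacent to the off-spine vertices of
    level at least i. The spine is recognised by the absence of far away
    4-cliques ([far_clique_off_spine]); its order is then visible in the
    graph, and since a well-order is rigid, spine vertices and levels are fixed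
    by every automorphism. The remaining edges, off the spine, make each colour
    recognisable and encode, at one colour p0 only, right multiplications
    g |-> g k of G, one level for each k. Permutations of G which commute with all
    right multiplications are left translations ([graph_aut_translate]). *)

Set Implicit Arguments.
Unset Strict Implicit.
Unset Printing Implicit Defensive.

Import Order.Theory.
Local Open Scope classical_set_scope.
Local Open Scope card_scope.

(** * Cardinal arithmetic *)

Lemma card_le_inj T U (f : T -> U) :
  injective f -> [set: T] #<= [set: U].
Proof.
move=> fI; have : set_inj [set: T] f by move=> x y _ _ /fI.
case/Pinj => g _; apply: inj_card_le; exact: ('totalfun_[set: T] g).
Qed.

Lemma card_leT_inj T U :
  [set: T] #<= [set: U] -> exists f : T -> U, injective f.
Proof.
case/card_leP => f; pose incl (x : T) : [set: T] := SigSub (mem_setT x).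
exists (fun x => val (f (incl x))) => x y /val_inj fxy.
have : incl x = incl y by apply: (inj (f := f)); rewrite ?inE.
by move/(congr1 val).
Qed.

Lemma card_le_fun T U (A : set T) (B : set U) : [set: U] !=set0 -> A #<= B ->
  exists2 f : T -> U, (forall x, A x -> B (f x)) &
    forall x y, A x -> A y -> f x = f y -> x = y.
Proof.
elim/Ppointed: U => U in B *.
  by move=> [x _]; have := no x.
move=> _ /pcard_leP/injfunPex[f fB fI].
by exists f => // x y Ax Ay; apply: fI; rewrite inE.
Qed.

(** Graphs of partial injections from A to B, the objects of the Zorn argument
    for the comparability of cardinals. *)
Definition partial_inj T (A B : set T) (R : set (T * T)) :=
  forall p q, R p -> R q -> [/\ A p.1, B p.2 & p.1 = q.1 <-> p.2 = q.2].

(** A maximal partial injection is total or onto: otherwise one more pair could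
    be added. *)
Lemma card_le_total T (A B : set T) : A #<= B \/ B #<= A.
Proof.
elim/Ppointed: T => T in A B *; first by left; rewrite emptyE_subdef.
have [F FP Ftot|R [RP Rmax]] := @Zorn_bigcup _ (partial_inj A B).
  move=> p q [X FX Xp] [Y FY Yq].
  have [XY|YX] := Ftot _ _ FX FY; first by apply: (FP _ FY) => //; apply: XY.
  by apply: (FP _ FX) => //; apply: YX.
have [Adom|] := pselect (A `<=` [set x | exists y, R (x, y)]).
  left; apply/pcard_leP.
  have /choice[f fR] x : exists y, A x -> R (x, y).
    by have [/Adom[y xy]|nA] := pselect (A x); [exists y | exists point].
  apply/injfunPex; exists f => [x Ax|x y xA yA fxy].
    by have [] := RP _ _ (fR _ Ax) (fR _ Ax).
  have [Ax Ay] := (set_mem xA, set_mem yA).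
  by have [_ _ /= [_ ->]] := RP _ _ (fR _ Ax) (fR _ Ay).
have [Brng _|] := pselect (B `<=` [set y | exists x, R (x, y)]).
  right; apply/pcard_leP.
  have /choice[f fR] y : exists x, B y -> R (x, y).
    by have [/Brng[x xy]|nB] := pselect (B y); [exists x | exists point].
  apply/injfunPex; exists f => [x Ax|x y xA yA fxy].
    by have [] := RP _ _ (fR _ Ax) (fR _ Ax).
  have [Ax Ay] := (set_mem xA, set_mem yA).
  by have [_ _ /= [<- //]] := RP _ _ (fR _ Ax) (fR _ Ay).
move=> /existsNP[b /not_implyP[Bb bR]] /existsNP[a /not_implyP[Aa aR]].
case: (Rmax (R `|` [set (a, b)])).
  split; first by move=> p Rp; left.
  by move=> /(_ (a, b)) sub; apply: aR; exists b; apply: sub; right.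
move=> [x y] [u v] [Rp|[-> ->]] [Rq|[-> ->]] /=; [exact: (RP _ _ Rp Rq)| | |by split].
  have [? ? _] := RP _ _ Rp Rp; split => //=.
  by split=> xy; subst; [case: aR; exists y | case: bR; exists x].
have [? ? _] := RP _ _ Rq Rq; split => //=.
by split=> xy; subst; [case: aR; exists v | case: bR; exists u].
Qed.

(** An infinite type is equipotent to its square. Zorn's lemma gives a maximal
    subset A with an injection of A * A into A. Then A
    does not inject into its complement, since the injection would extend to the
    union of A and a disjoint copy of A. By comparability the complement of A
    injects into A, so the whole type injects into A, and its square too. *)

Section SquareInjection.
Variables (K : Type) (i : nat -> K).
Hypothesis i_inj : injective i.

(** Three distinguished elements of the domain serve as tags when codes from
    different sources have to be kept apart. *)
Record partial_pairing := PartialPairing {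
  pdom :> K -> Prop;
  pair_of : K -> K -> K;
  pdom_base : pdom (i 0) /\ pdom (i 1) /\ pdom (i 2);
  pair_dom : forall x y, pdom x -> pdom y -> pdom (pair_of x y);
  pair_inj : forall x y x' y', pdom x -> pdom y -> pdom x' -> pdom y' ->
    pair_of x y = pair_of x' y' -> x = x' /\ y = y'
}.

Definition pairing_extends (s t : partial_pairing) : bool :=
  `[< (forall x, s x -> t x) /\ forall x y, s x -> s y -> pair_of s x y = pair_of t x y >].

Lemma countable_pairing : inhabited partial_pairing.
Proof.
have /choice[j jK] x : exists n, range i x -> i n = x.
  have [[n _ nx]|nr] := pselect (range i x); first by exists n.
  by exists 0.
have iK n : j (i n) = n by apply: i_inj; apply: jK; exists n.
split; apply: (@PartialPairing (range i)
  (fun x y => i (pickle (j x, j y)))) => //.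
move=> _ _ _ _ [a _ <-] [b _ <-] [c _ <-] [e _ <-] /i_inj.
by rewrite !iK => /(pcan_inj pickleK)[-> ->].
Qed.

Lemma chain_pairing (C : set partial_pairing) : total_on C pairing_extends ->
  exists t, forall s, C s -> pairing_extends s t.
Proof.
move=> Ctot; have [t0] := countable_pairing.
have [[c0 Cc0]|C0] := pselect (C !=set0); last first.
  by exists t0 => s Cs; case: C0; exists s.
have common s t : C s -> C t -> exists r, [/\ C r, pairing_extends s r &
    pairing_extends t r].
  move=> Cs Ct; have [st|ts] := Ctot _ _ Cs Ct.
    by exists t; split=> //; apply/asboolP.
  by exists s; split=> //; apply/asboolP.
pose A : set K := [set x | exists2 s, C s & pdom s x].
have /choice[f fP] (p : K * K) : exists z, forall s, C s -> s p.1 -> s p.2 ->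
    z = pair_of s p.1 p.2.
  have [[s [Cs sx sy]]|nos] := pselect (exists s, [/\ C s, s p.1 & s p.2]).
    exists (pair_of s p.1 p.2) => t Ct tx ty.
    have [r [_ /asboolP[_ sr] /asboolP[_ tr]]] := common _ _ Cs Ct.
    by rewrite sr // tr.
  by exists p.1 => s Cs sx sy; case: nos; exists s.
have both x y : A x -> A y -> exists s, [/\ C s, s x & s y].
  move=> [s Cs sx] [t Ct ty].
  have [r [Cr /asboolP[sr _] /asboolP[tr _]]] := common _ _ Cs Ct.
  by exists r; split; [|apply: sr|apply: tr].
have fE s x y : C s -> s x -> s y -> f (x, y) = pair_of s x y.
  by move=> Cs sx sy; rewrite (fP (x, y) s).
have A0 : A (i 0) /\ A (i 1) /\ A (i 2).
  by have [? [? ?]] := pdom_base c0; split; [|split]; exists c0.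
have AD x y : A x -> A y -> A (f (x, y)).
  move=> Ax Ay; have [s [Cs sx sy]] := both _ _ Ax Ay.
  by rewrite (fE s) //; exists s => //; apply: pair_dom.
have AI x y x' y' : A x -> A y -> A x' -> A y' ->
    f (x, y) = f (x', y') -> x = x' /\ y = y'.
  move=> /both xy /xy[s [Cs sx sy]] /both xy' /xy'[t [Ct tx ty]].
  have [r [Cr /asboolP[sr _] /asboolP[tr _]]] := common _ _ Cs Ct.
  have [rx ry rx' ry'] := And4 (sr _ sx) (sr _ sy) (tr _ tx) (tr _ ty).
  by rewrite !(fE r) //; apply: pair_inj.
exists (@PartialPairing A (fun x y => f (x, y)) A0 AD AI) => s Cs.
apply/asboolP; split=> [x sx|x y sx sy] /=; first by exists s.
by rewrite (fE s).
Qed.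

(** Pairs meeting the copy [h @` t] are sent into the copy: both coordinates are
    pulled back to [t] by the retraction [r], paired there, and tagged with the
    three ways in which a pair can meet the copy. *)
Lemma pairing_extension (t : partial_pairing) (h : K -> K) :
  (forall x, t x -> ~ t (h x)) ->
  (forall x y, t x -> t y -> h x = h y -> x = y) ->
  ~ premaximal pairing_extends t.
Proof.
move=> ht hI tmax; pose B : set K := (t : set K) `|` (h @` t).
have /choice[r rP] x : exists a, B x -> t a /\ (x = a \/ ~ t x /\ x = h a).
  have [tx|ntx] := pselect (t x); first by exists x => _; split=> //; left.
  have [[a ta <-]|nh] := pselect ((h @` t) x); last by exists x => -[].
  by exists a => _; split=> //; right; split=> //; apply: ht.
have rt x : t x -> r x = x.
  by move=> tx; have [|_ [<- //|[]]] := rP x; [left|].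
pose tag x y := if `[< t x >] then i 1 else if `[< t y >] then i 2 else i 0.
pose f x y := if `[< t x >] && `[< t y >] then pair_of t x y
  else h (pair_of t (pair_of t (r x) (r y)) (tag x y)).
have [t0 [t1 t2]] := pdom_base t.
have ttag x y : t (tag x y) by rewrite /tag; case: ifP => // _; case: ifP.
have tr x : B x -> t (r x) by move=> /rP[].
have tc x y : B x -> B y ->
    t (pair_of t (pair_of t (r x) (r y)) (tag x y)).
  by move=> Bx By; do 2 (apply: pair_dom => //); apply: tr.
have fE x y : t x -> t y -> f x y = pair_of t x y.
  by move=> tx ty; rewrite /f !asboolT.
have BD x y : B x -> B y -> B (f x y).
  move=> Bx By; rewrite /f; case: ifP => [/andP[/asboolP tx /asboolP ty]|_].
    by left; apply: pair_dom.
  by right; exists (pair_of t (pair_of t (r x) (r y)) (tag x y)) => //; apply: tc.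
have rI x y : B x -> B y -> `[< t x >] = `[< t y >] -> r x = r y -> x = y.
  move=> /rP[tx xE] /rP[ty yE] xy rxy.
  have txy : t x <-> t y by split=> /asboolP h0; apply/asboolP; rewrite ?xy // -xy.
  case: xE yE => [xE|[nx xE]] [yE|[ny yE]]; rewrite xE yE ?rxy //.
    by case: ny; apply/txy; rewrite xE.
  by case: nx; apply/txy; rewrite yE.
have BI x y x' y' : B x -> B y -> B x' -> B y' ->
    f x y = f x' y' -> x = x' /\ y = y'.
  move=> Bx By Bx' By'; rewrite /f.
  case: ifP => [/andP[/asboolP tx /asboolP ty]|n];
      case: ifP => [/andP[/asboolP tx' /asboolP ty']|n'].
  - exact: pair_inj.
  - by move=> fE'; case: (ht _ (tc _ _ Bx' By')); rewrite -fE'; apply: pair_dom.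
  - by move=> fE'; case: (ht _ (tc _ _ Bx By)); rewrite fE'; apply: pair_dom.
  move=> /(hI _ _ (tc _ _ Bx By) (tc _ _ Bx' By')) /pair_inj[]; rewrite ?ttag //.
  - by apply: pair_dom; apply: tr.
  - by apply: pair_dom; apply: tr.
  move=> /pair_inj[]; try by [|apply: tr].
  move=> rx ry tg.
  have [ex ey] : `[< t x >] = `[< t x' >] /\ `[< t y >] = `[< t y' >].
    move: n n' tg; rewrite /tag.
    case: `[< t x >]; case: `[< t y >]; case: `[< t x' >]; case: `[< t y' >];
      by move=> //= _ _ /i_inj.
  by split; apply: rI.
have B0 : B (i 0) /\ B (i 1) /\ B (i 2) by split; [|split]; left.
have /asboolP[Bt _] : pairing_extends (@PartialPairing B f B0 BD BI) t.
  apply: tmax; apply/asboolP; split=> [x tx|x y tx ty] /=; first by left.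
  by rewrite fE.
by apply: (ht _ t0); apply: Bt; right; exists (i 0).
Qed.

Lemma square_injection : exists p : K * K -> K, injective p.
Proof.
have [t0] := countable_pairing.
have [| |C Ctot|t tmax] := @ZL_preorder _ t0 pairing_extends.
- by move=> t; apply/asboolP.
- move=> r s t /asboolP[rs rsE] /asboolP[st stE]; apply/asboolP; split.
    by move=> x /rs /st.
  by move=> x y rx ry; rewrite rsE // stE //; apply: rs.
- exact: chain_pairing Ctot.
have [ti0 [ti1 ti2]] := pdom_base t.
have K0 : [set: K] !=set0 by exists (i 0).
have [] := card_le_total (~` (t : set K)) t; last first.
  by case/(card_le_fun K0) => h hC hI; case: (pairing_extension hC hI).
case/(card_le_fun K0) => g gt gI.
pose e x := if `[< t x >] then pair_of t x (i 0) else pair_of t (g x) (i 1).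
have et x : t (e x).
  by rewrite /e; case: asboolP => tx; apply: pair_dom => //; apply: gt.
have e_inj : injective e.
  move=> x y; rewrite /e; case: asboolP => tx; case: asboolP => ty.
  - by case/pair_inj.
  - by case/pair_inj => // [|_ /i_inj//]; apply: gt.
  - by case/pair_inj => // [|_ /i_inj//]; apply: gt.
  by case/pair_inj => //; try exact: gt; move=> /gI; auto.
exists (fun p => pair_of t (e p.1) (e p.2)) => -[x y] [x' y'] /=.
by move=> /pair_inj[] // /e_inj-> /e_inj->.
Qed.

End SquareInjection.

Lemma infinite_square T : infinite_set [set: T] ->
  [set: T * T] #<= [set: T].
Proof.
move=> /infiniteP/card_leT_inj[i i_inj].
by have [p p_inj] := square_injection i_inj; apply: card_le_inj p_inj.
Qed.

Section CardinalClosure.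
Variable K : Type.
Hypothesis K_infinite : infinite_set [set: K].

Lemma card_le_prod T U : [set: T] #<= [set: K] -> [set: U] #<= [set: K] ->
  [set: T * U] #<= [set: K].
Proof.
move=> /card_leT_inj[f fI] /card_leT_inj[g gI].
apply: card_le_trans (infinite_square K_infinite).
by apply: (@card_le_inj _ _ (fun p => (f p.1, g p.2))) => -[a b] [a' b'] [/fI-> /gI->].
Qed.

Lemma card_le_sum T U : [set: T] #<= [set: K] -> [set: U] #<= [set: K] ->
  [set: T + U] #<= [set: K].
Proof.
move=> /card_leT_inj[f fI] /card_leT_inj[g gI].
have /infiniteP/card_leT_inj[i iI] := K_infinite.
apply: card_le_trans (infinite_square K_infinite).
pose h s := match s with inl x => (i 0, f x) | inr y => (i 1, g y) end.
by apply: (@card_le_inj _ _ h) => -[a|a] [b|b] // [] => [/fI->|/iI|/iI|/gI->].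
Qed.

Lemma card_le_countable (T : countType) : [set: T] #<= [set: K].
Proof.
have /infiniteP := K_infinite; apply: card_le_trans.
exact: card_le_inj (pcan_inj pickleK).
Qed.

(** A sequence is coded by iterating one injection of [unit + T * K] into [K], the
    left summand standing for the empty sequence. *)
Lemma card_le_seq T : [set: T] #<= [set: K] -> [set: seq T] #<= [set: K].
Proof.
move=> TK; have /card_leT_inj[q qI] : [set: unit + T * K] #<= [set: K].
  by apply: card_le_sum; [exact: card_le_countable|exact: card_le_prod].
pose code := foldr (fun x k => q (inr (x, k))) (q (inl tt)).
apply: (@card_le_inj _ _ code); elim=> [|x s IH] [|y t] //= /qI // [-> /IH->].
by [].
Qed.

End CardinalClosure.

(** * Join-primes of a finite distributive lattice *)

Section JoinPrimes.
Context {dD : Order.disp_t} (D : finDistrLatticeType dD).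
Local Open Scope order_scope.
Implicit Types (a b x y p : D).

Definition join_prime p : Prop :=
  (exists x, ~~ (p <= x)) /\
  forall x y, p <= x `|` y -> (p <= x) || (p <= y).

(** An element minimal among those below a but not below b is join-prime, by
    distributivity. *)
Lemma join_prime_separates a b :
  ~~ (a <= b) -> exists p, [/\ join_prime p, p <= a & ~~ (p <= b)].
Proof.
move=> ab; pose P x := (x <= a) && ~~ (x <= b).
have Pa : P a by rewrite /P lexx.
case: (arg_minnP (fun x => #|[pred y | y <= x]|) Pa) => p /andP[pa pb] pmin.
have below x : x < p -> x <= b.
  move=> xp; apply/negPn/negP => xb.
  have /pmin : P x by rewrite /P xb (le_trans (ltW xp) pa).
  apply/negP; rewrite -ltnNge; apply/proper_card/properP; split.
    by apply/fintype.subsetP => y; rewrite !inE => /le_trans; apply; exact: ltW.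
  by exists p; rewrite !inE ?lexx // lt_geF.
exists p; split=> //; split=> [|x y pxy]; first by exists b.
apply: contraT; rewrite negb_or => /andP[px py]; case/negP: pb.
have -> : p = (p `&` x) `|` (p `&` y) by rewrite -meetUr; apply/esym/meet_idPl.
have meet_below z : ~~ (p <= z) -> p `&` z <= b.
  by move=> pz; apply: below; rewrite lt_neqAle leIl eq_meetl pz.
by rewrite leUx !meet_below.
Qed.

Lemma join_prime_le a b :
  (forall p, join_prime p -> p <= a -> p <= b) -> a <= b.
Proof.
move=> ab; apply: contraT => /join_prime_separates[p [pP pa /negP[]]].
exact: ab.
Qed.

(** Birkhoff duality: every down-set of join-primes is the set of join-primes
    below its join. *)
Lemma join_prime_downset (S : D -> Prop) : inhabited D ->
  (forall p q, join_prime p -> join_prime q -> p <= q -> S q -> S p) ->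
  exists d, forall p, join_prime p -> p <= d <-> S p.
Proof.
move=> [d0] Sdown; pose bot := foldr Order.meet d0 (enum D).
have bot_le x : bot <= x.
  rewrite /bot; have : x \in enum D by rewrite mem_enum.
  elim: (enum D) => //= y s IH; rewrite inE => /orP[/eqP->|/IH xs].
    exact: leIl.
  exact: le_trans (leIr _ _) xs.
pose r := [seq q <- enum D | `[< S q /\ join_prime q >]].
exists (foldr Order.join bot r) => p pP; split=> [|Sp]; last first.
  have : p \in r by rewrite mem_filter mem_enum andbT; apply/asboolP.
  elim: r => //= y s IH; rewrite inE => /orP[/eqP->|/IH ps].
    exact: leUl.
  exact: le_trans ps (leUr _ _).
have : forall q, q \in r -> S q /\ join_prime q.
  by move=> q; rewrite mem_filter => /andP[/asboolP].
elim: r => [_|y s IH yP] /=.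
  by move=> pb; case: pP => [[x /negP px] _]; case: px; exact: le_trans pb (bot_le x).
have [Sy jy] := yP y (mem_head _ _).
move=> /(pP.2) /orP[py|]; first exact: Sdown pP jy py Sy.
by apply: IH => q qs; apply: yP; rewrite inE qs orbT.
Qed.

End JoinPrimes.

(** * The lattice of closed sets of a coloured graph *)

Section ClosedSets.
Context {dD : Order.disp_t} {D : porderType dD} {V : Type}.
Variables (c : V -> D) (E : V -> V -> Prop).
Local Open Scope order_scope.

(** The direction matters: v fills u means that u and v together generate the
    whole colour class of u. *)
Definition fills u v := (c u = c v /\ E u v) \/ c u < c v.

Definition fill_closed (A : V -> Prop) :=
  (forall u v x, A u -> A v -> fills u v -> c x = c u -> A x) /\
  (forall u, A u -> (forall x, c x = c u -> A x) \/
    finite_set ([set x | A x /\ c x = c u])).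

Record closed_set := ClosedSet { elts :> V -> Prop; eltsP : fill_closed elts }.

Lemma closed_set_ext (A B : closed_set) : (forall x, A x <-> B x) -> A = B.
Proof.
case: A B => [A a] [B b] /= AB.
have E' : A = B by apply/funext => x; apply/propext.
by move: a b; rewrite E' => a b; congr ClosedSet; apply: Prop_irrelevance.
Qed.

HB.instance Definition _ := gen_eqMixin closed_set.
HB.instance Definition _ := gen_choiceMixin closed_set.

Definition closed_le (A B : closed_set) : bool := `[< forall x, A x -> B x >].

Fact closed_le_refl : reflexive closed_le.
Proof. by move=> A; apply/asboolP. Qed.

Fact closed_le_anti : antisymmetric closed_le.
Proof.
move=> A B /andP[/asboolP AB /asboolP BA]; apply: closed_set_ext => x.
by split; [exact: AB | exact: BA].
Qed.

Fact closed_le_trans : transitive closed_le.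
Proof.
by move=> B A C /asboolP AB /asboolP BC; apply/asboolP => x /AB /BC.
Qed.

Fact closed_display : Order.disp_t. Proof. exact: (Order.Disp tt tt). Qed.

HB.instance Definition _ := Order.Le_isPOrder.Build closed_display closed_set
  closed_le_refl closed_le_anti closed_le_trans.

Fact closed_meet_closed (A B : closed_set) : fill_closed (fun x => A x /\ B x).
Proof.
split=> [u v x [Au Bu] [Av Bv] uv xu|u [Au Bu]].
  split; [exact: (eltsP A).1 Au Av uv xu|exact: (eltsP B).1 Bu Bv uv xu].
have [Afull|Afin] := (eltsP A).2 _ Au; last first.
  by right; apply: sub_finite_set Afin => x [[]].
have [Bfull|Bfin] := (eltsP B).2 _ Bu; last first.
  by right; apply: sub_finite_set Bfin => x [[]].
by left=> x xu; split; [exact: Afull|exact: Bfull].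
Qed.

Definition closed_meet A B := ClosedSet (closed_meet_closed A B).

(** One step suffices to close the union of two closed sets, because filling
    adds vertices only in colours which are already present. *)
Definition fill_closure (U : V -> Prop) (x : V) : Prop :=
  U x \/ exists u v, [/\ U u, U v, fills u v & c u = c x].

Fact closed_join_closed (A B : closed_set) :
  fill_closed (fill_closure (fun x => A x \/ B x)).
Proof.
set U := fun x => _; have Ufin u : U u -> (forall x, c x = c u -> fill_closure U x) \/
    finite_set [set x | U x /\ c x = c u].
  have fin (C : closed_set) : (forall x, C x -> U x) ->
      (forall x, c x = c u -> fill_closure U x) \/ finite_set [set x | C x /\ c x = c u].
    move=> CU; have [[w Cw wu]|nw] := pselect (exists2 w, C w & c w = c u).
      have [full|fn] := (eltsP C).2 _ Cw; rewrite -wu; last by right.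
      by left=> x xw; left; apply/CU/full.
    right; rewrite (_ : [set x | _] = set0) //.
    by apply/seteqP; split=> // x [Cx xu]; apply: nw; exists x.
  move=> Uu; have [|Afull|Afin] := fin A; [by left|by left|].
  have [|Bfull|Bfin] := fin B; [by right|by left|].
  right; apply: (@sub_finite_set _ _ ([set x | A x /\ c x = c u] `|`
    [set x | B x /\ c x = c u])%classic); last by rewrite finite_setU.
  by move=> x [[Ax|Bx] xu]; [left|right].
have base u : fill_closure U u -> (exists2 w, U w & c w = c u) /\
    (U u \/ forall x, c x = c u -> fill_closure U x).
  case=> [Uu|[w [v [Uw Uv wv wu]]]]; split.
  - by exists u.
  - by left.
  - by exists w.
  by right=> x xu; right; exists w, v; rewrite xu.
split=> [u v x /base[[u' Uu' uu'] Ju] /base[[v' Uv' vv'] Jv] uv xu|u /base].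
  case: uv => [[cuv Euv]|cuv]; last first.
    by right; exists u', v'; rewrite xu; split=> //; right; rewrite uu' vv'.
  case: Ju => [Uu|]; last exact.
  case: Jv => [Uv|]; last by apply; rewrite xu.
  by right; exists u, v; rewrite xu; split=> //; left.
move=> [_ []]; last by left.
move=> Uu; have [full|fin] := Ufin _ Uu; first by left.
have [full|nfull] := pselect (forall x, c x = c u -> fill_closure U x).
  by left.
right; apply: sub_finite_set fin => x [Jx xu]; split=> //.
by have [_ [//|full]] := base _ Jx; case: nfull => y yu; apply: full; rewrite xu.
Qed.

Definition closed_join A B := ClosedSet (closed_join_closed A B).

Fact closed_meetP (A B C : closed_set) :
  (A <= closed_meet B C) = (A <= B) && (A <= C).
Proof.
apply/asboolP/andP => [ABC|[/asboolP AB /asboolP AC] x Ax].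
  by split; apply/asboolP => x /ABC[].
by split; [exact: AB|exact: AC].
Qed.

Fact closed_joinP (A B C : closed_set) :
  (closed_join A B <= C) = (A <= C) && (B <= C).
Proof.
apply/asboolP/andP => [ABC|[/asboolP AC /asboolP BC]].
  by split; apply/asboolP => x xA; apply: ABC; left; [left|right].
have UC x : A x \/ B x -> C x by case; [exact: AC|exact: BC].
move=> x [/UC//|[u [v [/UC Cu /UC Cv uv ux]]]].
exact: (eltsP C).1 Cu Cv uv (esym ux).
Qed.

HB.instance Definition _ := Order.POrder_MeetJoin_isLattice.Build
  closed_display closed_set closed_meetP closed_joinP.

Lemma meetE (A B : closed_set) x : (A `&` B) x = (A x /\ B x).
Proof. by []. Qed.

Lemma joinE (A B : closed_set) x :
  (A `|` B) x = fill_closure (fun x => A x \/ B x) x.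
Proof. by []. Qed.

End ClosedSets.

(** * Congruences of the lattice of closed sets *)

Section OrderIso.
Context {d d' : Order.disp_t} {L : latticeType d} {M : latticeType d'}.
Local Open Scope order_scope.

Lemma order_iso_lattice_iso (f : L -> M) :
  bijective f -> (forall x y, (f x <= f y) = (x <= y)) -> lattice_iso f.
Proof.
move=> fbij fle; case: (fbij) => g fK gK; split=> // x y; apply/le_anti/andP.
  split; first by rewrite lexI !fle leIl leIr.
  by rewrite -[f x `&` f y]gK fle lexI -!fle gK leIl leIr.
split; last by rewrite leUx !fle leUl leUr.
by rewrite -[f x `|` f y]gK fle leUx -!fle gK leUl leUr.
Qed.

End OrderIso.

Section Congruences.
Context {dD : Order.disp_t} {D : finDistrLatticeType dD} {V : Type}.
Variables (c : V -> D) (E : V -> V -> Prop).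
Local Open Scope order_scope.
Local Notation L := (closed_set c E).

(** Whether a vertex is generated depends only on members of its own colour and
    of higher colours. This makes [agree_off] compatible with joins. *)
Lemma fill_closure_off d (U W : V -> Prop) :
  (forall v, ~~ (c v <= d) -> U v -> W v) ->
  forall v, ~~ (c v <= d) -> fill_closure c E U v -> fill_closure c E W v.
Proof.
move=> UW v vd [Uv|[u [w [Uu Uw uw uv]]]]; first by left; apply: UW.
right; exists u, w; split=> //; apply: UW => //; first by rewrite uv.
apply: contra vd; rewrite -uv; apply: le_trans.
by case: uw => [[-> _]//|/ltW].
Qed.

#[local] Obligation Tactic := idtac.

(** The congruence attached to d: membership is forgotten at the colours below
    d. *)
Program Definition agree_off (d : D) : Con L :=
  @MkCon _ _ (fun A B => forall v, ~~ (c v <= d) -> A v <-> B v) _ _ _ _ _.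
Next Obligation. by []. Qed.
Next Obligation. by move=> d A B AB v vd; rewrite AB. Qed.
Next Obligation. by move=> d A B C AB BC v vd; rewrite AB // BC. Qed.
Next Obligation.
by move=> d A A' B B' AA' BB' v vd; rewrite !meetE AA' // BB'.
Qed.
Next Obligation.
move=> d A A' B B' AA' BB' v vd; rewrite !joinE.
by split; apply: (fill_closure_off (d := d)) => // w wd; rewrite AA' // BB'.
Qed.

Lemma union_of_classes_closed (S : D -> Prop) : fill_closed c E (fun x => S (c x)).
Proof. by split=> [u v x Su Sv uv ->|u Su] //; left=> x ->. Qed.

Definition union_of_classes S : L := ClosedSet (union_of_classes_closed S).

Hypothesis E_irr : forall u, ~ E u u.
Hypothesis E_col : forall u v, E u v -> c u = c v.
Hypothesis E_ngb : forall u, exists w, E u w.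
Hypothesis E_avoid : forall w,
  exists u v, [/\ E u v, c u = c w, u <> w & v <> w].
Hypothesis c_prime : forall v, join_prime (c v).
Hypothesis c_surj : forall p, join_prime p -> exists v, c v = p.

Lemma fills_irr u : ~ fills c E u u.
Proof. by case=> [[_ /E_irr]|]; rewrite ?ltxx. Qed.

Lemma single_closed v : fill_closed c E (fun x => x = v).
Proof.
split=> [u w x -> -> /fills_irr|u ->] //; right.
by apply: (@sub_finite_set _ _ [set v]) => // x [].
Qed.

Definition single v : L := ClosedSet (single_closed v).

Lemma agree_off_le d e : (agree_off d <= agree_off e) = (d <= e).
Proof.
apply/asboolP/idP => [de|de A B AB v ve]; last first.
  by apply: AB; apply: contra ve => /le_trans; apply.
apply: join_prime_le => p /c_surj[v <-] vd; apply: contraT => ve.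
have : agree_off d (union_of_classes (fun=> False)) (union_of_classes (eq (c v))).
  by move=> x xd /=; split=> // vx; rewrite -vx vd in xd.
by move/de/(_ v ve) => /= [_ /(_ erefl)].
Qed.

Local Notation bot := (union_of_classes (fun=> False)).

Definition collapsed (a : Con L) p := a bot (union_of_classes (fun q => q = p)).

(** As soon as v is identified with the empty set, joining with a neighbour w
    identifies the class of v with w alone, and meeting with any other vertex of
    the class collapses that vertex. Two adjacent vertices other than w
    then generate the class, which is collapsed as well. *)
Lemma con_collapse (a : Con L) (A B : L) v : a A B -> A v -> ~ B v ->
  collapsed a (c v).
Proof.
move=> AB Av nBv.
have v0 : a (single v) bot.
  have := con_meet AB (con_refl a (single v)).
  have -> : A `&` single v = single v.
    by apply: closed_set_ext => x; rewrite meetE /=; split=> [[]|->].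
  have -> // : B `&` single v = bot.
  by apply: closed_set_ext => x; rewrite meetE /=; split=> [[Bx xv]|//]; case: nBv; rewrite -xv.
have joinbot (C : L) : bot `|` C = C by apply/join_r/asboolP => x [].
have edge u w : E u w -> single u `|` single w = union_of_classes (fun q => q = c u).
  move=> uw; apply: closed_set_ext => x; rewrite joinE /=; split; last first.
    by move=> xu; right; exists u, w; split; auto; left; split; auto.
  by case=> [[->//|->]|[y [z [[->|->] _ _ <-]]]] //; rewrite (E_col uw).
have [w vw] := E_ngb v.
have wC : a (union_of_classes (fun q => q = c v)) (single w).
  by have := con_join v0 (con_refl a (single w)); rewrite edge // joinbot.
have u0 u : c u = c v -> u <> w -> a (single u) bot.
  move=> uv uw; have := con_meet wC (con_refl a (single u)).
  have -> : union_of_classes (fun q => q = c v) `&` single u = single u.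
    by apply: closed_set_ext => x; rewrite meetE /=; split=> [[]|->].
  have -> // : single w `&` single u = bot.
  by apply: closed_set_ext => x; rewrite meetE /=; split=> [[-> /esym]|].
have [u [u' [uu' cu uw u'w]]] := E_avoid w.
rewrite -(E_col vw) in cu.
have := con_join (u0 u cu uw) (u0 u' (etrans (esym (E_col uu')) cu) u'w).
by rewrite edge // joinbot cu => /con_sym.
Qed.

(** Joining a collapsed class with a vertex u of a lower colour identifies u with
    its whole class, which contains a neighbour of u. *)
Lemma collapsed_down (a : Con L) p q : join_prime p -> join_prime q ->
  p <= q -> collapsed a q -> collapsed a p.
Proof.
move=> /c_surj[u <-] /c_surj[v <-]; rewrite le_eqVlt => /predU1P[->//|uv].
move=> a0; have [w uw] := E_ngb u; rewrite (E_col uw).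
have := con_join a0 (con_refl a (single u)) => /con_sym/con_collapse; apply.
  by right; exists u, v; split; [right|left|right|exact: E_col].
case=> [[//|/= wu]|[x [y [[//|/= ->] [//|/= ->] /fills_irr//]]]].
by case: (E_irr (u := u)); rewrite -{2}wu.
Qed.

Lemma agree_off_surj (d0 : D) (a : Con L) : exists d, agree_off d = a.
Proof.
have [d dP] := join_prime_downset (inhabits d0) (@collapsed_down a).
exists d; apply: con_ext => A B; split=> AB; last first.
  move=> v vd; split=> [Av|Bv]; apply: contrapT => nv.
    by have := con_collapse AB Av nv; rewrite -dP // (negPf vd).
  by have := con_collapse (con_sym AB) Bv nv; rewrite -dP // (negPf vd).
(* The join of all collapsed classes is itself collapsed, and joining with it
   erases all information at colours below d. *)
pose T (s : seq D) := union_of_classes (fun q => q \in s).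
have T0 s : (forall q, q \in s -> join_prime q /\ q <= d) -> a bot (T s).
  elim: s => [_|q s IH qP].
    rewrite (_ : T [::] = bot); first exact: con_refl.
    by apply: closed_set_ext => x; rewrite /= in_nil.
  have [qprime /(dP _ qprime) q0] := qP q (mem_head _ _).
  have s0 : a bot (T s) by apply: IH => r rs; apply: qP; rewrite inE rs orbT.
  have := con_join q0 s0; rewrite joinxx.
  congr (a _ _); apply: closed_set_ext => x; rewrite joinE /= inE.
  split=> [[xqs|[u [v [uqs _ _ <-]]]]|/predU1P xqs]; last by left.
    exact/predU1P.
  exact/predU1P.
pose s := [seq q <- enum D | (q <= d) && `[< join_prime q >]].
have sE v : (c v \in s) = (c v <= d).
  by rewrite mem_filter mem_enum andbT asboolT ?andbT.
have /T0 s0 : forall q, q \in s -> join_prime q /\ q <= d.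
  by move=> q; rewrite mem_filter mem_enum andbT => /andP[? /asboolP].
have up (C : L) : a C (C `|` T s).
  have := con_join (con_refl a C) s0.
  by rewrite (_ : C `|` bot = C) //; apply/join_l/asboolP => x [].
apply: con_trans (up A) _; apply: con_sym; rewrite (_ : A `|` T s = B `|` T s) //.
apply: closed_set_ext => x; rewrite !joinE.
have [xd|xd] := boolP (c x <= d).
  by split=> _; left; right => /=; rewrite sE.
by split; apply: (fill_closure_off (d := d)) => // v vd; rewrite /= sE (negPf vd) AB.
Qed.

Lemma con_iso (d0 : D) : lattices_isomorphic D (Con L).
Proof.
have /choice[f fK] := agree_off_surj d0.
exists agree_off; apply: order_iso_lattice_iso; last exact: agree_off_le.
exists f => // d; apply/le_anti.
by rewrite -!agree_off_le !fK lexx.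
Qed.

End Congruences.

(** * Counting filters and ideals *)

Lemma card_le_set T U : [set: T] #<= [set: U] ->
  [set: set T] #<= [set: set U].
Proof.
move=> /card_leT_inj[f fI]; apply: (@card_le_inj _ _ (fun A => f @` A)).
move=> A B AB; apply/seteqP; split=> x Ax.
  by have [y By /fI<-] : (f @` B) (f x) by rewrite -AB; exists x.
by have [y By /fI<-] : (f @` A) (f x) by rewrite AB; exists x.
Qed.

Section Counting.
Context {dD : Order.disp_t} {D : finDistrLatticeType dD} {V : eqType}.
Variables (c : V -> D) (E : V -> V -> Prop).
Local Open Scope order_scope.
Local Notation L := (closed_set c E).
Implicit Types (A B : L) (F : set L).

Lemma nonfull_finite A :
  finite_set [set x | A x /\ ~ (forall y, c y = c x -> A y)].
Proof.
apply: (@sub_finite_set _ _ (\bigcup_(q in [set: D])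
    [set x | A x /\ c x = q /\ ~ (forall y, c y = q -> A y)])).
  by move=> x [Ax nf]; exists (c x).
apply: bigcup_finite => // q _.
have [[x [Ax [<- nf]]]|no] := pselect ([set x | A x /\ c x = q /\
    ~ (forall y, c y = q -> A y)] !=set0)%classic; last first.
  by rewrite (_ : [set x | _]%classic = set0) //; apply/eqP/negP => /negP/set0P.
have [//|] := (eltsP A).2 x Ax.
by apply: sub_finite_set => y [Ay [yx _]].
Qed.

Lemma nonfull_seq A : exists s : seq V,
  forall x, x \in s <-> A x /\ ~ (forall y, c y = c x -> A y).
Proof.
have /finite_seqP[s sE] := nonfull_finite A; exists s => x.
by have /= <- := congr1 (fun S : set V => S x) sE.
Qed.

(** Finitely many conditions that pass to smaller sets and are each met by some
    member of a filter are met together by one member. *)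
Lemma filter_forall_seq F (T : eqType) (P : T -> L -> Prop) (s : seq T) :
  lattice_filter F ->
  (forall t A B, P t A -> B <= A -> P t B) ->
  (forall t, exists2 A, F A & P t A) ->
  exists2 A, F A & {in s, forall t, P t A}.
Proof.
move=> [[A0 FA0] _ Fmeet] Pdown Pex; elim: s => [|t s [A FA As]]; first by exists A0.
have [B FB Bt] := Pex t; exists (A `&` B); first exact: Fmeet.
move=> u /predU1P[->|/As Au]; first exact: Pdown Bt (leIr _ _).
exact: Pdown Au (leIl _ _).
Qed.

(** A member of F is as small as possible at a vertex v if it omits v or if all
    members contain v. Such members exist for every finite set of vertices.
    Within one colour, either all members of F are full, or some member has
    only finitely many vertices there; so one member is as small as possible on
    a whole colour, and then, the colours being finite in number, everywhere. *)
Lemma filter_principal F : lattice_filter F ->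
  exists A, F = [set B | A <= B]%classic.
Proof.
move=> Ffil; have [_ Fup Fmeet] := Ffil.
pose least v A := A v -> forall B, F B -> B v.
have least_down v A B : least v A -> B <= A -> least v B.
  by move=> Av /asboolP BA /BA.
have least_ex v : exists2 A, F A & least v A.
  have [[A FA nAv]|allv] := pselect (exists2 A, F A & ~ A v).
    by exists A.
  have [[A0 FA0] _ _] := Ffil; exists A0 => // _ B FB.
  by apply: contrapT => nBv; apply: allv; exists B.
have [A FA Aleast] : exists2 A, F A & forall p v, c v = p -> least v A.
  pose P p A := forall v, c v = p -> least v A.
  have [||A FA AP] := @filter_forall_seq F D P (enum D) Ffil.
  - by move=> p A B PA BA v vp; apply: least_down BA; apply: PA.
  - move=> p; have [[A [FA nf]]|allfull] :=
      pselect (exists A, F A /\ ~ (forall y, c y = p -> A y)).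
      have [s sP] := nonfull_seq A.
      have [B FB Bs] := filter_forall_seq s Ffil least_down least_ex.
      exists (A `&` B); first exact: Fmeet.
      move=> v vp; rewrite /least meetE => -[Av Bv]; apply: (Bs v) => //.
      by apply/sP; rewrite vp.
    have [[A0 FA0] _ _] := Ffil; exists A0 => // v vp _ B FB.
    apply: contrapT => nBv; apply: allfull; exists B; split=> // /(_ v vp).
    exact: nBv.
  by exists A => // p; apply: AP; rewrite mem_enum inE.
exists A; apply/seteqP; split=> B /=; last by move=> AB; apply: Fup AB FA.
by move=> FB; apply/asboolP => v Av; apply: (Aleast _ v erefl).
Qed.

Lemma card_filters : [set F : set L | lattice_filter F] #= [set: L].
Proof.
rewrite (_ : [set F : set L | lattice_filter F]%classic =
    (fun A => [set B | A <= B]%classic) @` [set: L]%classic).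
  apply: inj_card_eq => A B _ _ AB.
  have AB' C : A <= C <-> B <= C.
    by have /= -> := congr1 (fun F : set L => F C) AB.
  by apply/le_anti/andP; split; [apply/AB'|apply/AB'].
apply/seteqP; split=> [F /filter_principal[A ->]|_ [A _ <-]]; first by exists A.
split=> [|x y xy /= Ax|x y /= Ax Ay]; first by exists A => /=.
  exact: le_trans Ax xy.
by rewrite lexI Ax.
Qed.

Variable K : Type.
Hypothesis K_infinite : infinite_set [set: K].
Hypothesis V_le_K : [set: V] #<= [set: K].
Hypothesis E_irr : forall u, ~ E u u.
Variable h : K -> V.
Hypothesis h_inj : injective h.
Hypothesis h_indep : forall k l, ~ fills c E (h k) (h l).

(** A closed set is coded by the colours where it is full and the finite list of
    its remaining vertices. *)
Lemma card_closed_set : [set: L] #= [set: K].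
Proof.
apply: Cantor_Bernstein; last first.
  apply: (@card_le_inj _ _ (fun k => single c E_irr (h k))) => k l.
  move=> /(congr1 (fun A : L => A (h k))) /= hkl.
  by apply: h_inj; rewrite -hkl.
apply: (@card_le_trans _ _ _ [set: {set D} * seq V]%classic); last first.
  apply: card_le_prod => //; [exact: card_le_countable|exact: card_le_seq].
have /choice[f fP] A : exists p : {set D} * seq V,
    forall x, A x <-> c x \in p.1 \/ x \in p.2.
  have [s sP] := nonfull_seq A.
  exists ([set q | `[< forall y, c y = q -> A y >]]%SET, s) => x /=.
  rewrite sP inE; split=> [Ax|[/asboolP|[]//]]; last exact.
  by have [?|?] := pselect (forall y, c y = c x -> A y); [left; apply/asboolP|right].
apply: (@card_le_inj _ _ f) => A B AB; apply: closed_set_ext => x.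
by rewrite !fP AB.
Qed.

Definition supported_below (S : set K) : set L :=
  [set A | forall x, A x -> exists2 k, S k & h k = x]%classic.

Lemma supported_below_ideal S : lattice_ideal (supported_below S).
Proof.
split=> [|A B /asboolP AB BS x /AB/BS//|A B AS BS x].
  by exists (union_of_classes c E (fun=> False)) => x [].
have US y : A y \/ B y -> exists2 k, S k & h k = y by case=> [/AS|/BS].
rewrite joinE => -[/US//|[u [v [/US[k _ <-] /US[l _ <-] kl _]]]].
by case: (h_indep kl).
Qed.

Lemma card_ideals : [set I : set L | lattice_ideal I] #= [set: set K].
Proof.
apply: Cantor_Bernstein.
  apply: card_le_trans (card_leT _) _; apply: card_le_set.
  by have /card_eqPle[] := card_closed_set.
have Sh S k : supported_below S (single c E_irr (h k)) <-> S k.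
  split=> [/(_ (h k) erefl)[l Sl /h_inj<-//]|Sk _ ->]; by exists k.
have : $|{injfun [set: set K]%classic >->
    [set I : set L | lattice_ideal I]%classic}|.
  apply/injfunPex; exists supported_below => [S _|S S' _ _ SS'].
    exact: supported_below_ideal.
  by apply/funext => k; apply/propext; rewrite -Sh SS' Sh.
by case=> f; apply: inj_card_le f.
Qed.

End Counting.

(** * Automorphisms of the lattice of closed sets *)

Section LatticeAutomorphisms.
Context {dD : Order.disp_t} {D : finDistrLatticeType dD} {V : Type}.
Variables (c : V -> D) (E : V -> V -> Prop).
Local Open Scope order_scope.
Local Notation L := (closed_set c E).
Hypothesis E_irr : forall u, ~ E u u.
Hypothesis E_sym : forall u v, E u v -> E v u.
Hypothesis E_col : forall u v, E u v -> c u = c v.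
Hypothesis E_avoid : forall w,
  exists u v, [/\ E u v, c u = c w, u <> w & v <> w].
Local Notation single := (single c E_irr).
Local Notation bot := (union_of_classes c E (fun=> False)).
Implicit Types (f : LAut L) (A B : L) (u v w x : V).

Lemma single_le v A : (single v <= A) <-> A v.
Proof. by split=> [/asboolP/(_ v erefl)//|Av]; apply/asboolP => x ->. Qed.

Lemma single_inj : injective single.
Proof. by move=> u v /(congr1 (fun A : L => A u))/= uv; rewrite -uv. Qed.

Lemma laut_inj f : injective f.
Proof. by case: (laut_iso f) => /bij_inj. Qed.

Lemma laut_le f A B : (f A <= f B) = (A <= B).
Proof.
have [_ fm _] := laut_iso f.
by rewrite !leEmeet -fm (inj_eq (@laut_inj f)).
Qed.

Lemma laut_invK f A : f (laut_inv f A) = A.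
Proof. by rewrite -[f _]/(laut_comp f (laut_inv f) A) laut_compfV. Qed.

Lemma laut_Kinv f A : laut_inv f (f A) = A.
Proof. by rewrite -[laut_inv f _]/(laut_comp (laut_inv f) f A) laut_compVf. Qed.

(** Both [f (single v)] and its inverse image under [f] of one of its points
    are nonempty, and [single v] has no smaller nonempty element. *)
Lemma laut_single f v : exists w, f (single v) = single w.
Proof.
have bot_le A : bot <= A by apply/asboolP.
have [[w fw]|no] := pselect (exists w, f (single v) w); last first.
  have : single v <= bot.
    rewrite -(laut_le f); apply: le_trans (bot_le _).
    by apply/asboolP => x fx; case: no; exists x.
  by move/single_le.
exists w; apply/le_anti/andP; split; last exact/single_le.
rewrite -[single w](laut_invK f) laut_le; apply/single_le.
have [[x gx]|no] := pselect (exists x, laut_inv f (single w) x); last first.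
  have : single w <= bot.
    rewrite -[single w](laut_invK f) -(laut_le (laut_inv f)) laut_Kinv.
    by apply/asboolP => x gx; case: no; exists x.
  by move/single_le.
have : laut_inv f (single w) <= single v.
  by rewrite -(laut_le f) laut_invK; apply/single_le.
by move=> /asboolP/(_ x gx) /= xv; rewrite -xv.
Qed.

Lemma laut_vertex f : exists s : V -> V,
  (forall v, f (single v) = single (s v)) /\ forall A v, f A (s v) <-> A v.
Proof.
have /choice[s sP] := laut_single f; exists s; split=> // A v.
by rewrite -single_le -sP -[A v]single_le laut_le.
Qed.

Definition span u v : V -> Prop := (single u `|` single v : L).

Lemma spanP u v x : span u v x <-> [\/ x = u, x = v,
  fills c E u v /\ c x = c u | fills c E v u /\ c x = c v].
Proof.
rewrite /span joinE; split=> [[[]|[y [z [/= yP zP yz yx]]]]|].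
- by constructor 1.
- by constructor 2.
- case: yP zP yz yx => -> [->|->] uv ux; try by case: (fills_irr E_irr uv).
    by constructor 3.
  by constructor 4.
case=> [->|->|[uv xu]|[vu xv]]; [by left; left|by left; right| |]; right.
  by exists u, v; split; rewrite ?xu //=; auto.
by exists v, u; split; rewrite ?xv //=; auto.
Qed.

(** A lattice-theoretic statement about three atoms at a time: u lies in the join
    of two atoms other than u, both below the join of u and v. *)
Definition regenerates u v :=
  exists x y, [/\ x <> u, y <> u, span u v x, span u v y & span x y u].

(** When u and v are adjacent their join contains the whole class of u, in which
    an edge avoiding u generates u again. *)
Lemma edge_regenerates u v : E u v -> regenerates u v.
Proof.
move=> uv; have [x [y [xy xu nxu nyu]]] := E_avoid u.
exists x, y; split=> //; apply/spanP.
- by constructor 3; split=> //; left; split=> //; apply: E_col.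
- by constructor 3; split; [left; split=> //; apply: E_col|rewrite -(E_col xy)].
by constructor 3; split=> //; left; split=> //; apply: E_col.
Qed.

(** If v has a lower colour than u then u is the only vertex of its colour below
    the join of u and v, and lower colours do not generate it. *)
Lemma lt_not_regenerates u v : c v < c u -> ~ regenerates u v.
Proof.
move=> vu [x [y [xu yu ux uy /spanP xyu]]].
have below z : z <> u -> span u v z -> c z = c v.
  move=> zu /spanP[//|->//|[[[uv _]|uv] _]|[_ ->]] //.
    by rewrite uv ltxx in vu.
  by have := lt_trans uv vu; rewrite ltxx.
have cx := below x xu ux; have cy := below y yu uy.
suff cu : c u = c v by rewrite cu ltxx in vu.
by case: xyu => [->|->|[_ ->]|[_ ->]].
Qed.

Lemma edge_span u v : E u v <-> regenerates u v /\ regenerates v u.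
Proof.
split=> [uv|[ruv rvu]].
  by split; apply: edge_regenerates => //; apply: E_sym.
have [[[_ //]|uv]|nuv] := pselect (fills c E u v).
  by case: (lt_not_regenerates uv).
have [[[_ /E_sym//]|vu]|nvu] := pselect (fills c E v u).
  by case: (lt_not_regenerates vu).
case: ruv => x [y [xu yu /spanP ux /spanP uy /spanP xyu]].
have {ux} xv : x = v by case: ux => [//|//|[]|[]].
have {uy} yv : y = v by case: uy => [//|//|[]|[]].
by move: xyu; rewrite xv yv; case=> [uv|uv|[/(fills_irr E_irr)]|[/(fills_irr E_irr)]] //;
  case: xu; rewrite xv uv.
Qed.

Lemma laut_vertex_edge f : exists s : V -> V,
  [/\ bijective s, forall u v, E (s u) (s v) <-> E u v &
      forall A v, f A (s v) <-> A v].
Proof.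
have [s [sf sA]] := laut_vertex f.
have [t [tf _]] := laut_vertex (laut_inv f).
have sK : cancel s t.
  by move=> v; apply: single_inj; rewrite -tf -sf laut_Kinv.
have tK : cancel t s.
  by move=> v; apply: single_inj; rewrite -sf -tf laut_invK.
have sspan u v x : span (s u) (s v) (s x) = span u v x.
  have [_ _ fj] := laut_iso f; apply/propext.
  by rewrite /span -!sf -fj sA.
have sreg u v : regenerates (s u) (s v) <-> regenerates u v.
  split=> [[x [y]]|[x [y [xu yu ux uy xyu]]]].
    rewrite -[x]tK -[y]tK !sspan => -[xu yu ux uy xyu].
    by exists (t x), (t y); split=> // e; [case: xu|case: yu]; rewrite e.
  exists (s x), (s y); rewrite !sspan.
  by split=> // /(can_inj sK).
exists s; split=> //; first by exists t.
by move=> u v; rewrite !edge_span !sreg.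
Qed.

Variables (G : groupType) (act : G -> V -> V).
Hypothesis act1 : forall v, act 1%g v = v.
Hypothesis actM : forall g h v, act (g * h)%g v = act g (act h v).
Hypothesis act_col : forall g v, c (act g v) = c v.
Hypothesis act_edge : forall g u v, E u v -> E (act g u) (act g v).
Hypothesis act_faithful : forall g, (forall v, act g v = v) -> g = 1%g.
Hypothesis act_full : forall s : V -> V, bijective s ->
  (forall u v, E (s u) (s v) <-> E u v) -> exists g, forall v, s v = act g v.

Lemma actK g : cancel (act g) (act g^-1%g).
Proof. by move=> v; rewrite -actM mulVg act1. Qed.

Lemma actVK g : cancel (act g^-1%g) (act g).
Proof. by move=> v; rewrite -actM mulgV act1. Qed.

Lemma act_fills g u v : fills c E u v -> fills c E (act g u) (act g v).
Proof.
by case=> [[cuv uv]|cuv]; [left|right]; rewrite !act_col //; split=> //; apply: act_edge.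
Qed.

(** The image of A under g, written as a preimage under the inverse so that
    composition of translations becomes composition of automorphisms. *)
Lemma lift_closed g A : fill_closed c E (fun x => A (act g^-1%g x)).
Proof.
split=> [u v x Au Av uv xu|u Au].
  by apply: (eltsP A).1 Au Av (act_fills _ uv) _; rewrite !act_col.
have [full|fin] := (eltsP A).2 _ Au; [left=> x xu|right].
  by apply: full; rewrite !act_col.
apply: sub_finite_set (finite_preimage (f := act g^-1%g) _ fin).
  by move=> x [Ax xu]; split=> //=; rewrite !act_col.
by move=> x y _ _ /(can_inj (actVK g)).
Qed.

Definition lift_fun g A : L := ClosedSet (lift_closed g A).

Lemma lift_funK g : cancel (lift_fun g) (lift_fun g^-1%g).
Proof. by move=> A; apply: closed_set_ext => x /=; rewrite invgK actK. Qed.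

Lemma lift_iso g : lattice_iso (lift_fun g).
Proof.
have K := lift_funK g; have := lift_funK g^-1%g; rewrite invgK => K'.
apply: order_iso_lattice_iso; first by exists (lift_fun g^-1%g).
have mono h A B : A <= B -> lift_fun h A <= lift_fun h B.
  by move=> /asboolP AB; apply/asboolP => x /AB.
move=> A B; apply/idP/idP; last exact: mono.
by move=> /(mono g^-1%g); rewrite !K.
Qed.

Definition lift g : LAut L := MkLAut (lift_iso g).

Lemma laut_group_iso : groups_isomorphic G (LAut L).
Proof.
exists lift; last first.
  by move=> g h; apply: laut_ext => A; apply: closed_set_ext => x /=;
    rewrite invgM actM.
have /choice[k kP] f : exists g, lift g = f.
  have [s [sb sE sA]] := laut_vertex_edge f.
  have [g sg] := act_full sb sE; exists g.
  apply: laut_ext => A; apply: closed_set_ext => x /=.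
  by rewrite -[in f A x](actVK g x) -sg sA.
exists k => // g; have : lift (k (lift g)) = lift g by rewrite kP.
move: (k _) => h hg; have gh v : act g^-1%g v = act h^-1%g v.
  have := congr1 (fun f : LAut L => f (single (act g^-1%g v)) v) hg.
  by move=> /= e; apply/esym; rewrite e.
suff : (h * g^-1)%g = 1%g by move/(canRL (mulgVK _)); rewrite mul1g.
by apply: act_faithful => v; rewrite actM gh actVK.
Qed.

End LatticeAutomorphisms.

(** * Well-orders *)

Definition well_ordered T (le : T -> T -> Prop) :=
  (forall x y, le x y -> le y x -> x = y) /\
  (forall A : set T, A !=set0 -> exists2 m, A m & forall x, A x -> le m x).

Section WellOrder.
Variables (T : Type) (le : T -> T -> Prop).
Hypothesis wo : well_ordered le.

Lemma wo_refl x : le x x.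
Proof.
have [|m mx mle] := wo.2 [set x]; first by exists x.
by rewrite -{1}[x]mx; apply: mle.
Qed.

Lemma wo_total x y : le x y \/ le y x.
Proof.
have [|m [mx|my] mle] := wo.2 [set x; y]; first by exists x; left.
  by left; rewrite -{1}mx; apply: mle; right.
by right; rewrite -{1}my; apply: mle; left.
Qed.

Lemma wo_trans x y z : le x y -> le y z -> le x z.
Proof.
move=> xy yz; have [|m mxyz mle] := wo.2 [set x; y; z].
  by exists x; left; left.
have mx : le m x by apply: mle; left; left.
have my : le m y by apply: mle; left; right.
suff -> : x = m by apply: mle; right.
case: mxyz => [[->|my']|mz] //.
  by apply: wo.1 => //; rewrite my'.
have yE : y = m by apply: wo.1 => //; rewrite mz.
by apply: wo.1 => //; rewrite -yE.
Qed.

(** At the least moved point m, either the image or the preimage of m lies below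
    m, hence is fixed, which contradicts injectivity. *)
Lemma wo_rigid (s : T -> T) : (forall y, exists x, s x = y) ->
  (forall x y, le (s x) (s y) <-> le x y) -> forall x, s x = x.
Proof.
move=> s_surj s_le x; apply: contrapT => sx.
have s_inj y z : s y = s z -> y = z.
  by move=> yz; apply: wo.1; rewrite -s_le yz; apply: wo_refl.
have [|m /= sm mle] := wo.2 [set x | s x <> x]; first by exists x.
have fixed y : le y m -> y <> m -> s y = y.
  by move=> ym nym; apply: contrapT => /mle my; apply: nym; apply: wo.1.
have [smm|msm] := wo_total (s m) m.
  by apply: (sm); apply: s_inj; apply: fixed.
have [y ym] := s_surj m.
have ny : y <> m by move=> yE; apply: sm; rewrite -{1}yE.
by apply: (ny); rewrite -ym fixed // -s_le ym.
Qed.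

End WellOrder.

Lemma well_order_exists T : exists le : T -> T -> Prop, well_ordered le.
Proof.
elim/Peq: T => T; have [R Rwo] := well_ordering_principle T.
have Ranti := wo_chain_antisymmetric (withinW (A := predT) Rwo).
exists (fun x y => R x y); split=> [x y xy yx|A [a Aa]].
  by apply: Ranti; rewrite ?xy.
have [|z [[zA zmin] _]] := Rwo [pred x | `[< A x >]].
  by exists a; apply/asboolP.
by exists z; [exact/asboolP|move=> x Ax; apply: zmin; apply/asboolP].
Qed.

(** The ordinal sum: appending a copy of the natural numbers removes any greatest
    element and provides indices that are distinct from the elements of T. *)
Definition sum_le T (le : T -> T -> Prop) (x y : T + nat) : Prop :=
  match x, y with
  | inl a, inl b => le a b
  | inl _, inr _ => True
  | inr _, inl _ => False
  | inr m, inr n => (m <= n)%N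
  end.

Lemma sum_well_ordered T (le : T -> T -> Prop) :
  well_ordered le -> well_ordered (sum_le le).
Proof.
move=> [anti min]; split=> [[a|m] [b|n] //= xy yx|A [x Ax]].
- by rewrite (anti a b).
- by congr inr; apply/eqP; rewrite eqn_leq xy.
have [[a Aa]|noA] := pselect ([set a | A (inl a)] !=set0).
  have [|m Am mle] := min [set a | A (inl a)]; first by exists a.
  by exists (inl m) => // -[b /mle|].
case: x Ax => [a Aa|n An]; first by case: noA; exists a.
have exn : exists n, `[< A (inr n) >] by exists n; apply/asboolP.
case: (ex_minnP exn) => m /asboolP Am mmin.
exists (inr m) => // -[b Ab|k Ak]; first by case: noA; exists b.
by apply: mmin; apply/asboolP.
Qed.

Lemma sum_no_max T (le : T -> T -> Prop) x :
  well_ordered le -> exists y, sum_le le x y /\ x <> y.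
Proof.
case: x => [a|n] _; first by exists (inr 0%N).
by exists (inr n.+1); split=> //= -[] /eqP; rewrite ltn_eqF.
Qed.

(** * A rigid coloured graph with a prescribed group *)

Section ColouredGraph.
Context {dD : Order.disp_t} (D : finDistrLatticeType dD).
Variables (G : groupType) (K : Type) (f : G -> K) (p0 : D).
Variable le : K + nat -> K + nat -> Prop.

(** The index set is [K + nat], where [f] embeds G in the left summand. A vertex
    has a colour and a position: [inl i] is the spine vertex with index i, while
    [inr (g, i)] is an off-spine vertex of level i labelled by g. Labels other
    than 1 occur only at the colour p0. *)
Definition valid_position (p : D) (x : (K + nat) + G * (K + nat)) : Prop :=
  match x with inl _ => True | inr (g, _) => p = p0 \/ g = 1%g end.

Record vertex := Vertex {
  colour : D;
  position : (K + nat) + G * (K + nat);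
  colour_prime : join_prime colour;
  positionP : valid_position colour position
}.

Lemma vertex_ext v w :
  colour v = colour w -> position v = position w -> v = w.
Proof.
case: v w => [p x jp vx] [q y jq vy] /= pq xy; subst.
by congr Vertex; apply: Prop_irrelevance.
Qed.

HB.instance Definition _ := gen_eqMixin vertex.

(** The level of the hub depends on the colour and is the only thing which
    distinguishes the graphs carried by two colours other than p0. *)
Definition hub (p : D) : K + nat := inr (enum_rank p).+1.

(** There are two sorts of arcs. A vertex at the hub level is joined to the
    vertices of all other levels with the same label, so that an automorphism
    acts in the same way on the labels of all levels. At level [inl (f k)], the
    vertex g is joined to the vertex [g * k] of level [inr 0], which records
    right multiplication by k. *)
Definition arc p (x y : G * (K + nat)) : Prop :=
  [/\ x.2 = hub p, y.2 <> hub p & x.1 = y.1] \/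
  exists k, [/\ x.2 = inl (f k), y.2 = inr 0 & y.1 = (x.1 * k)%g].

Definition joined p x y : Prop :=
  match x, y with
  | inl i, inl j => i <> j
  | inl i, inr (_, j) => le i j
  | inr (_, i), inl j => le j i
  | inr a, inr b => arc p a b \/ arc p b a
  end.

Definition edge v w :=
  colour v = colour w /\ joined (colour v) (position v) (position w).

Lemma hub_inj p q : hub p = hub q -> p = q.
Proof. by move=> [] /val_inj/enum_rank_inj. Qed.

Lemma edge_sym v w : edge v w -> edge w v.
Proof.
rewrite /edge => -[-> e]; split=> //; move: e; rewrite /joined.
by case: (position v) (position w) => [i|[g i]] [j|[h j]]; [exact: nesym| | |case; auto].
Qed.

Lemma edge_irr v : ~ edge v v.
Proof.
case=> _; rewrite /joined; case: (position v) => [i|[g i]]; first by [].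
by case=> -[[/= i0 /(_ i0)]|[k [/= -> //]]].
Qed.

(** A proper 3-colouring of the graph off the spine, which therefore contains no
    4-clique. *)
Definition shade (p : D) (i : K + nat) : option bool :=
  match i with
  | inl _ => None
  | inr 0 => Some false
  | inr n.+1 => if n == enum_rank p then Some true else None
  end.

Lemma arc_shade p x y : arc p x y -> shade p x.2 <> shade p y.2.
Proof.
case=> [[-> y0 _]|[k [-> -> _]]] //=; rewrite eqxx.
case: y.2 y0 => [k //|[//|n]] y0 /=; case: eqP => // n0; case: y0.
by rewrite n0.
Qed.

Hypothesis le_wo : well_ordered le.
Hypothesis le_no_max : forall i, exists j, le i j /\ i <> j.

Definition on_spine v := if position v is inl _ then true else false.

Definition far v x := [/\ colour x = colour v, x <> v & ~ edge v x].

(** Four pairwise adjacent vertices in the colour class of v, all different from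
    v and not adjacent to it. *)
Definition far_clique v := exists x y z t,
  [/\ far v x, far v y, far v z & far v t] /\
  [/\ edge x y, edge x z & edge x t] /\ [/\ edge y z, edge y t & edge z t].

Lemma strict_wo_trans i j k :
  le i j /\ i <> j -> le j k /\ j <> k -> le i k /\ i <> k.
Proof.
move=> [ij nij] [jk njk]; split; first exact: wo_trans le_wo _ _ _ ij jk.
by move=> ik; apply: nij; apply: le_wo.1; rewrite // ik.
Qed.

(** A spine vertex is adjacent to the whole spine, so its non-neighbours are off
    the spine and contain no 4-clique. An off-spine vertex of level i is not
    adjacent to any spine vertex with index above i, and there are infinitely
    many of those. *)
Lemma far_clique_off_spine v : far_clique v <-> ~~ on_spine v.
Proof.
split=> [[x [y [z [t [[vx vy vz vt] [[xy xz xt] [yz yt zt]]]]]]]|].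
  apply/negP => v_spine.
  have off w : far v w -> exists a, position w = inr a.
    case=> wv nwv nw; case wE : (position w) => [i|a]; last by exists a.
    move: v_spine; rewrite /on_spine; case vE : (position v) => [j|//] _.
    case: nw; split=> //; rewrite vE wE => ji.
    by apply: nwv; apply: vertex_ext; rewrite // vE wE ji.
  have shade_neq (a b : vertex) g h : edge a b -> far v a ->
      position a = inr g -> position b = inr h ->
      shade (colour v) g.2 <> shade (colour v) h.2.
    case=> _ ab [av _ _] aE bE; move: ab; rewrite aE bE /= av.
    case: g aE => g i aE; case: h bE => h j bE.
    by case=> /arc_shade // ne e; apply: ne.
  have [[gx xE] [gy yE] [gz zE] [gt tE]] := And4 (off x vx) (off y vy) (off z vz) (off t vt).
  have := shade_neq _ _ _ _ xy vx xE yE; have := shade_neq _ _ _ _ xz vx xE zE.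
  have := shade_neq _ _ _ _ xt vx xE tE; have := shade_neq _ _ _ _ yz vy yE zE.
  have := shade_neq _ _ _ _ yt vy yE tE; have := shade_neq _ _ _ _ zt vz zE tE.
  by case: (shade _ gx.2) => [[]|]; case: (shade _ gy.2) => [[]|];
     case: (shade _ gz.2) => [[]|]; case: (shade _ gt.2) => [[]|].
rewrite /on_spine; case vE : (position v) => [//|[g i]] _.
have [x ix] := le_no_max i; have [y xy] := le_no_max x.
have [z yz] := le_no_max y; have [t zt] := le_no_max z.
have [iy iz] : (le i y /\ i <> y) /\ (le i z /\ i <> z).
  by split; [exact: strict_wo_trans ix xy|exact: strict_wo_trans (strict_wo_trans ix xy) yz].
have it := strict_wo_trans iz zt; have xz := strict_wo_trans xy yz.
have xt := strict_wo_trans xz zt; have yt := strict_wo_trans yz zt.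
pose A j := @Vertex (colour v) (inl j) (colour_prime v) I.
have farA j : le i j /\ i <> j -> far v (A j).
  move=> [ij nij]; split=> //; first by move=> /(congr1 position); rewrite vE.
  by case=> _; rewrite vE /= => ji; apply: nij; apply: le_wo.1.
have edgeA j k : le j k /\ j <> k -> edge (A j) (A k) by move=> [].
exists (A x), (A y), (A z), (A t); split; first by split; apply: farA.
by split; split; apply: edgeA.
Qed.

Definition spine p (pP : join_prime p) i := @Vertex p (inl i) pP I.
Definition rib p (pP : join_prime p) i :=
  @Vertex p (inr (1%g, i)) pP (or_intror erefl).

Lemma bottom_exists : exists i, forall j, le i j.
Proof.
have [|i _ ile] := le_wo.2 [set: K + nat]; first by exists (inr 0).
by exists i => j; apply: ile.
Qed.

(** The least spine vertex of a colour is adjacent to all other vertices of that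
    colour. *)
Lemma colour_eqP v w : colour v = colour w <->
  exists x, (v = x \/ edge v x) /\ (x = w \/ edge x w).
Proof.
split=> [vw|[x [vx xw]]]; last first.
  by case: vx xw => [<-|[-> _]] [<-|[-> _]].
have [b b_le] := bottom_exists; pose x := spine (colour_prime v) b.
have x_near u : colour u = colour v -> u = x \/ edge u x.
  move=> uv; have [->|nux] := pselect (u = x); [by left|right]; split=> //=.
  case uE : (position u) => [i|[g i]] //=.
  by move=> ib; apply: nux; apply: vertex_ext; rewrite //= uE ib.
exists x; split; first exact: x_near.
by have [->|/edge_sym] := x_near w (esym vw); [left|right].
Qed.

(** The order of the spine in terms of adjacency: neighbourhoods off the spine
    shrink along the spine. *)
Definition dominates u v :=
  forall w, ~~ on_spine w -> edge v w -> edge u w.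

Lemma dominatesP p (pP : join_prime p) i j :
  dominates (spine pP i) (spine pP j) <-> le i j.
Proof.
split=> [/(_ (rib pP j) isT)[]//|ij w].
  by split=> //=; apply: wo_refl le_wo _.
rewrite /on_spine; case wE : (position w) => [//|[g k]] _ [pw].
by rewrite wE /= => jk; split; rewrite // wE /=; apply: (wo_trans le_wo) jk.
Qed.

Definition graph_aut (s : vertex -> vertex) :=
  bijective s /\ forall v w, edge (s v) (s w) <-> edge v w.

Section Rigidity.
Variables s : vertex -> vertex.
Hypothesis s_aut : graph_aut s.

Lemma aut_inj : injective s. Proof. exact: bij_inj s_aut.1. Qed.

Lemma aut_edge v w : edge (s v) (s w) = edge v w.
Proof. exact/propext/s_aut.2. Qed.

Lemma aut_colour v w : colour v = colour w -> colour (s v) = colour (s w).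
Proof.
move=> /colour_eqP[x [vx xw]]; apply/colour_eqP; exists (s x).
by rewrite !aut_edge; split; [case: vx => [->|]|case: xw => [->|]]; auto.
Qed.

Lemma aut_far v x : far v x -> far (s v) (s x).
Proof.
case=> xv nxv nvx; split; [exact: aut_colour|by move/aut_inj|].
by rewrite aut_edge.
Qed.

Lemma aut_far_clique v : far_clique v -> far_clique (s v).
Proof.
move=> [x [y [z [t [[? ? ? ?] [[? ? ?] [? ? ?]]]]]]].
exists (s x), (s y), (s z), (s t).
by rewrite !aut_edge; split; first by split; apply: aut_far.
Qed.

End Rigidity.

Lemma aut_inverse s : graph_aut s -> exists t,
  [/\ graph_aut t, cancel s t & cancel t s].
Proof.
move=> [[t sK tK] s_edge]; exists t; split=> //; split; first by exists s.
by move=> v w; rewrite -s_edge !tK.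
Qed.

Section RigidityContinued.
Variables s : vertex -> vertex.
Hypothesis s_aut : graph_aut s.

Lemma aut_spine v : on_spine (s v) = on_spine v.
Proof.
have [t [t_aut sK tK]] := aut_inverse s_aut.
have flip (a b : bool) : (~~ a <-> ~~ b) -> a = b.
  by move=> [ab ba]; apply/idP/idP; apply: contraTT.
apply: flip; rewrite -!far_clique_off_spine; split; last exact: (aut_far_clique s_aut).
by move/(aut_far_clique t_aut); rewrite sK.
Qed.

(** On the spine of one colour an automorphism induces an order isomorphism onto
    the spine of some colour, hence the identity on indices. *)
Lemma aut_spine_position v i :
  position v = inl i -> position (s v) = inl i.
Proof.
have [t [t_aut sK tK]] := aut_inverse s_aut.
move=> vi; have pP := colour_prime v.
have vE : v = spine pP i by apply: vertex_ext.
set p := colour v in pP vE; rewrite vE => {vE}.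
pose q := colour (s (spine pP i)); have qP : join_prime q by apply: colour_prime.
have /choice[r rP] j : exists k, s (spine pP j) = spine qP k.
  have : on_spine (s (spine pP j)) by rewrite aut_spine.
  rewrite /on_spine; case sE : (position _) => [k|//] _; exists k.
  by apply: vertex_ext => //; apply: (aut_colour s_aut).
have dominates_s u w : dominates (s u) (s w) <-> dominates u w.
  have imp (a : vertex -> vertex) x y : graph_aut a ->
      (forall z, on_spine (a z) = on_spine z) ->
      dominates x y -> dominates (a x) (a y).
    move=> a_aut a_spine xy z.
    have [b [_ _ bK]] := aut_inverse a_aut.
    by rewrite -[z]bK a_spine !aut_edge //; apply: xy.
  split; last by apply: (imp s _ _ s_aut aut_spine).
  rewrite -{2}[u]sK -{2}[w]sK; apply: (imp t _ _ t_aut) => z.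
  by rewrite -[LHS]aut_spine tK.
rewrite rP /=; congr inl; apply: (wo_rigid le_wo) => [j|j k].
  have : on_spine (t (spine qP j)) by rewrite -aut_spine tK.
  rewrite /on_spine; case tE : (position _) => [k|//] _; exists k.
  have tS : t (spine qP j) = spine pP k.
    apply: vertex_ext => //=; rewrite -[RHS]/(colour (spine pP i)).
    by rewrite -[spine pP i]sK; apply: (aut_colour t_aut).
  by have := rP k; rewrite -tS tK => /(congr1 position) [].
by rewrite -(dominatesP qP) -!rP dominates_s dominatesP.
Qed.

(** The level of an off-spine vertex is the greatest index of a spine vertex
    adjacent to it. *)
Lemma aut_rib_position v g i :
  position v = inr (g, i) -> exists h, position (s v) = inr (h, i).
Proof.
move=> vE; have : ~~ on_spine (s v) by rewrite aut_spine /on_spine vE.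
rewrite /on_spine; case sE : (position (s v)) => [//|[h j]] _; exists h.
have below k : le k i <-> le k j.
  pose a := spine (colour_prime v) k.
  have sa : position (s a) = inl k by apply: aut_spine_position.
  have ca : colour (s a) = colour (s v) by apply: (aut_colour s_aut).
  have : edge (s a) (s v) <-> edge a v by rewrite aut_edge.
  rewrite /edge sa sE vE /= ca => -[h1 h2].
  by split=> kk; [have [] := h2 (conj erefl kk)|have [] := h1 (conj erefl kk)].
congr (inr (_, _)); apply: le_wo.1; first by apply/below; apply: wo_refl le_wo _.
by apply/below; apply: wo_refl le_wo _.
Qed.

(** An edge between the hub level of the colour p and level [inr 0] is mapped to
    an edge between the same levels at the new colour q. Level [inr 0] is
    otherwise joined only to levels in the left summand, so the hub level of p
    is the hub level of q, and p is q. *)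
Lemma aut_colour_fixed v : colour (s v) = colour v.
Proof.
pose b := rib (colour_prime v) (hub (colour v)).
pose x := rib (colour_prime v) (inr 0).
have : edge (s b) (s x) by rewrite aut_edge //; split=> //=; left; left.
have [g sb] := aut_rib_position (v := b) erefl.
have [h sx] := aut_rib_position (v := x) erefl.
case=> _; rewrite sb sx /= (aut_colour s_aut (w := v)) //.
case=> -[[/= ]|[k [//= ]]] //.
by move=> /hub_inj.
Qed.

Hypothesis f_inj : injective f.
Hypothesis p0_prime : join_prime p0.

(** The edges at the hub show that an automorphism permutes the labels by one
    map a, the same on all levels. The other edges show that a (g * k) = a g * k;
    for g = 1 this says that a is the left translation by a 1. *)
Lemma aut_translation : exists g, forall v, colour v = p0 ->
  forall h i, position v = inr (h, i) -> position (s v) = inr ((g * h)%g, i).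
Proof.
pose B g i := @Vertex p0 (inr (g, i)) p0_prime (or_introl erefl).
have /choice[a aP] g : exists h, position (s (B g (hub p0))) = inr (h, hub p0).
  exact: aut_rib_position.
have copies g i : position (s (B g i)) = inr (a g, i).
  have [->|ni] := pselect (i = hub p0); first exact: aP.
  have [h hE] : exists h, position (s (B g i)) = inr (h, i).
    exact: aut_rib_position.
  have : edge (s (B g (hub p0))) (s (B g i)).
    by rewrite aut_edge //; split=> //=; left; left.
  case=> _; rewrite aP hE aut_colour_fixed /=.
  by case=> -[[/= _ _ ->]|[k [//= ]]] //.
have step g k : a (g * k)%g = (a g * k)%g.
  have : edge (s (B g (inl (f k)))) (s (B (g * k)%g (inr 0))).
    by rewrite aut_edge //; split=> //=; left; right; exists k.
  case=> _; rewrite !copies aut_colour_fixed /=.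
  case=> -[[//= ]|[l [//= ]]].
  by case=> /f_inj -> _ ->.
exists (a 1%g) => v vp h i vE.
have -> : v = B h i by apply: vertex_ext.
by rewrite copies -step mul1g.
Qed.

End RigidityContinued.

Definition translate_position p g (x : (K + nat) + G * (K + nat)) :=
  match x with
  | inl i => inl i
  | inr (h, i) => if p == p0 then inr ((g * h)%g, i) else inr (h, i)
  end.

Lemma translate_valid v g :
  valid_position (colour v) (translate_position (colour v) g (position v)).
Proof.
case: v => p [i|[h i]] pP //= [->|->]; first by rewrite eqxx; left.
by case: eqP => [->|_]; [left|right].
Qed.

Definition translate g v : vertex :=
  Vertex (colour_prime v) (translate_valid v g).

Lemma translate1 v : translate 1%g v = v.
Proof.
apply: vertex_ext => //=; case: (position v) => [//|[h i]] /=.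
by rewrite mul1g; case: ifP.
Qed.

Lemma translateM g h v : translate (g * h)%g v = translate g (translate h v).
Proof.
apply: vertex_ext => //=; case: (position v) => [//|[k i]] /=.
by case: ifP => /= pE; rewrite pE ?mulgA.
Qed.

Lemma translate_edge g v w : edge v w -> edge (translate g v) (translate g w).
Proof.
case=> vw e; split=> //=; rewrite -vw; move: e.
case: (position v) (position w) => [i|[h i]] [j|[k j]] //=; case: ifP => //= _.
by case=> -[[/= ? ? ->]|[l [/= ? ? ->]]]; [left; left|left; right; exists l|
  right; left|right; right; exists l]; split; rewrite //= mulgA.
Qed.

Lemma translate_faithful g : join_prime p0 ->
  (forall v, translate g v = v) -> g = 1%g.
Proof.
move=> p0P /(_ (rib p0P (inr 0)))/(congr1 position) /=.
by rewrite eqxx mulg1 => -[].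
Qed.

Lemma graph_aut_translate s : injective f -> join_prime p0 -> graph_aut s ->
  exists g, forall v, s v = translate g v.
Proof.
move=> fI p0P s_aut; have [g gP] := aut_translation s_aut fI p0P.
exists g => v; apply: vertex_ext; first exact: (aut_colour_fixed s_aut).
rewrite /=; case vE : (position v) => [i|[h i]] /=.
  exact: (aut_spine_position s_aut).
case: eqP => [vp|vp]; first exact: gP.
have [k sE] := aut_rib_position s_aut vE; rewrite sE.
have := positionP v; have := positionP (s v).
by rewrite vE sE (aut_colour_fixed s_aut) /= => -[//|->] [//|->].
Qed.

Lemma edge_neighbour v : exists w, edge v w.
Proof.
case vE : (position v) => [i|[g i]].
  have [j [_ ij]] := le_no_max i.
  by exists (spine (colour_prime v) j); split; rewrite ?vE.
exists (spine (colour_prime v) i); split; rewrite ?vE //=.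
exact: wo_refl le_wo _.
Qed.

Lemma edge_avoiding w :
  exists u v, [/\ edge u v, colour u = colour w, u <> w & v <> w].
Proof.
pose i := match position w with inl i => i | inr (_, i) => i end.
have [j ij] := le_no_max i; have [k jk] := le_no_max j.
have ik := strict_wo_trans ij jk.
have neq l : i <> l -> spine (colour_prime w) l <> w.
  by move=> il /(congr1 position) e; apply: il; rewrite /i -e.
exists (spine (colour_prime w) j), (spine (colour_prime w) k).
by split=> //; [split=> //; case: jk|apply: neq; case: ij|apply: neq; case: ik].
Qed.

Lemma colour_surj p : join_prime p -> exists v, colour v = p.
Proof. by move=> pP; exists (spine pP (inr 0)). Qed.

(** The levels in the left summand are joined only to the hub and to level
    [inr 0]. *)
Lemma ribs_independent (pP : join_prime p0) (k l : K) :
  ~ fills colour edge (rib pP (inl k)) (rib pP (inl l)).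
Proof.
case=> [[_ [_]]|]; last by rewrite ltxx.
by case=> -[[]|[m []]].
Qed.

Lemma card_vertices : infinite_set [set: K] -> [set: G] #<= [set: K] ->
  [set: vertex] #<= [set: K].
Proof.
move=> K_inf GK.
have IK : [set: K + nat] #<= [set: K].
  by apply: card_le_sum => //; exact: card_le_countable.
apply: (@card_le_trans _ _ _ [set: D * ((K + nat) + G * (K + nat))]); last first.
  apply: card_le_prod => //; first exact: card_le_countable.
  by apply: card_le_sum => //; exact: card_le_prod.
apply: (@card_le_inj _ _ (fun v => (colour v, position v))) => v w [].
exact: vertex_ext.
Qed.

End ColouredGraph.

(** * The representation theorem *)

Theorem corollary1p5 (dD : Order.disp_t) (D : finDistrLatticeType dD)
    (G : groupType) (K : Type)
    (D_nontrivial : (1 < #|D|)%N)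
    (K_infinite : infinite_set [set: K])
    (GK : [set: G] #<= [set: K]) :
  exists (d : Order.disp_t) (L : latticeType d),
    [/\ [set I : set L | lattice_ideal I] #= [set: set K],
        [set F : set L | lattice_filter F] #= [set: K],
        lattices_isomorphic D (Con L)
      & groups_isomorphic G (LAut L)].
Proof.
have [p0 p0P] : exists p : D, join_prime p.
  have /card_gt1P[a [b [_ _ ab]]] := D_nontrivial.
  have : ~~ ((a <= b)%O && (b <= a)%O).
    by apply: contra ab => /le_anti->.
  by rewrite negb_and => /orP[] /join_prime_separates[p [pP _ _]]; exists p.
have [f f_inj] := card_leT_inj GK.
have [leK leK_wo] := well_order_exists K.
pose le := sum_le leK.
have le_wo : well_ordered le := sum_well_ordered leK_wo.
have le_no_max i : exists j, le i j /\ i <> j := sum_no_max i leK_wo.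
pose V := vertex G K p0; pose c : V -> D := @colour _ _ _ _ _.
pose E : V -> V -> Prop := edge f le.
have E_irr u : ~ E u u := @edge_irr _ _ _ _ f p0 le u.
have E_avoid := edge_avoiding f (p0 := p0) le_wo le_no_max.
pose h k : V := rib G p0 p0P (inl k).
have h_inj : injective h by move=> k l [].
have h_indep : forall k l, ~ fills c E (h k) (h l).
  exact: ribs_independent.
have VK := card_vertices p0 K_infinite GK.
exists _, (closed_set c E); split.
- exact: card_ideals K_infinite VK E_irr _ h_inj h_indep.
- apply: card_eq_trans (card_filters _ _) _.
  exact: card_closed_set K_infinite VK E_irr _ h_inj.
- apply: con_iso => //.
  + by move=> u v [].
  + exact: edge_neighbour.
  + exact: colour_prime.
  + exact: colour_surj.
apply: (laut_group_iso E_irr _ _ E_avoid (act := @translate _ _ _ _ _)) => //.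
- exact: edge_sym.
- by move=> u v [].
- exact: translate1.
- exact: translateM.
- exact: translate_edge.
- by move=> g; apply: translate_faithful.
- by move=> s s_bij s_edge; apply: (graph_aut_translate le_wo le_no_max f_inj p0P).
Qed.
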